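(* Let $p\ge1$ be an integer, $N\in\mathbb{Z}_+$, $\bar a_k,\bar b_k\in\mathbb{R}$, $q_k,r_k,\bar q_k,\bar r_k>0$ for $k\in\{0,\dots,N-1\}$, and $q_N,\bar q_N>0$. Let $(\epsilon_k)_k$ be a zero-mean real random process with $\epsilon_0=0$, and let $x_0$ be a given real random variable independent of $\epsilon$. Consider the problem of minimizing $\mathbb{E}[L(x_0,u)]$, where $$L(x_0,u)=q_N\,\mathrm{var}(x_N)+\bar q_N\bar x_N^{2p}+\sum_{k=0}^{N-1}\left(q_k\,\mathrm{var}(x_k)+\bar q_k\bar x_k^{2p}+r_k\,\mathrm{var}(u_k)+\bar r_k\bar u_k^{2p}\right),$$ over admissible controls $u=(u_k)_{k\in\{0,\dots,N-1\}}$, subject to $$x_{k+1}=\bar a_kx_k+\bar b_ku_k+\epsilon_{k+1},\qquad k\in\{0,\dots,N-1\}.$$ Then the optimal control input is $$u_k^*=-\frac{\alpha_{k+1}\bar b_k\bar a_k}{r_k+\alpha_{k+1}\bar b_k^2}(x_k-\bar x_k)-\frac{\left(\frac{\bar\alpha_{k+1}\bar b_k}{\bar r_k}\right)^{1/(2p-1)}\bar a_k}{1+\left(\frac{\bar\alpha_{k+1}\bar b_k}{\bar r_k}\right)^{1/(2p-1)}\bar b_k}\,\bar x_k,$$ where $\bar\alpha,\bar\gamma,\alpha$ solve, for $k\in\{0,\dots,N-1\}$, the recursive equations $$\bar\alpha_k=\bar q_k+\bar r_k\left(\frac{\left(\frac{\bar\alpha_{k+1}\bar b_k}{\bar r_k}\right)^{1/(2p-1)}\bar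 a_k}{1+\left(\frac{\bar\alpha_{k+1}\bar b_k}{\bar r_k}\right)^{1/(2p-1)}\bar b_k}\right)^{2p}+\bar\alpha_{k+1}\left(\bar a_k-\bar b_k\frac{\left(\frac{\bar\alpha_{k+1}\bar b_k}{\bar r_k}\right)^{1/(2p-1)}\bar a_k}{1+\left(\frac{\bar\alpha_{k+1}\bar b_k}{\bar r_k}\right)^{1/(2p-1)}\bar b_k}\right)^{2p},$$ $$\bar\gamma_k=\bar\gamma_{k+1}+\alpha_{k+1}\mathbb{E}(\epsilon_{k+1}^2),$$ $$\alpha_k=q_k+r_k\left(\frac{\alpha_{k+1}\bar b_k\bar a_k}{r_k+\alpha_{k+1}\bar b_k^2}\right)^2+\alpha_{k+1}\left(\bar a_k-\frac{\alpha_{k+1}\bar b_k^2\bar a_k}{r_k+\alpha_{k+1}\bar b_k^2}\right)^2,$$ with $\bar\alpha_N=\bar q_N$, $\bar\gamma_N=0$, $\alpha_N=q_N$.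
   Context: Notation: $\bar x_k=\mathbb{E}[x_k]$, $\bar u_k=\mathbb{E}[u_k]$, $\mathrm{var}(x)=\mathbb{E}[(x-\bar x)^2]$, $\mathrm{var}(u)=\mathbb{E}[(u-\bar u)^2]$. $(\cdot)^{1/(2p-1)}$ is the real odd root (defined also for negative arguments). Moments appearing in the recursions are understood to be finite real numbers. Admissible controls are sequences $(u_k)_{k\in\{0,\dots,N-1\}}$ of real-valued Lebesgue measurable controls with $\bar u_k^{2p}<+\infty$, in state-feedback form: $u_k$ is a function of the current state $x_k$ that may also depend on the distribution of $x_k$ (for instance through $\bar x_k$). ''Optimal'' means attaining the minimum of the expected cost over admissible controls.
   Formalization: The noise is assumed zero-mean conditionally on its past (E[ε_{k+1}|ε_0,…,ε_k]=0, e.g. independent noise), since with merely zero-mean correlated noise the claim fails; the admissible controls are Borel rather than Lebesgue measurable functions of the state. *)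

(* Defs.v *)
(* MathComp-Analysis *)
From HB Require Import structures.
From mathcomp Require Import all_boot all_order all_algebra.
From mathcomp Require Import all_classical all_reals all_analysis.
From mathcomp Require Import measurable_realfun.

Set Implicit Arguments.
Unset Strict Implicit.
Unset Printing Implicit Defensive.

Import Order.TTheory GRing.Theory Num.Theory.
Import numFieldNormedType.Exports.

Local Open Scope classical_set_scope.
Local Open Scope ring_scope.

(* The real m-th root for odd m: the unique real y with y ^+ m = x. *)
Definition odd_root {R : realType} (m : nat) (x : R) : R :=
  Num.sg x * (`|x| `^ (m%:R)^-1).

Section noise.
Context {d : measure_display} {T : measurableType d} {R : realType}.
Variable P : probability T R.

(* sigma(X) and sigma(eps_0, ..., eps_k) *)
Definition sigma_rv (X : {RV P >-> R}) : set (set T) :=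
  <<s [set A | exists2 C : set R, measurable C & A = X @^-1` C] >>.

Definition sigma_upto (eps : nat -> {RV P >-> R}) (k : nat) : set (set T) :=
  <<s [set A | exists j : nat, (j <= k)%N /\
         exists2 C : set R, measurable C & A = eps j @^-1` C] >>.

Definition indep_rv_process (X : {RV P >-> R}) (eps : nat -> {RV P >-> R})
    (N : nat) : Prop :=
  forall A B : set T, sigma_rv X A -> sigma_upto eps N B ->
    P (A `&` B) = (P A * P B)%E.

(* E[eps_(k+1) | eps_0, ..., eps_k] = 0 for k < N; for a zero-mean process
   this holds in particular when the eps_k are mutually independent.  With
   noise that can be predicted from its past, linear feedback with the Riccati
   gain is in general not optimal. *)
Definition zero_mean_given_past (eps : nat -> {RV P >-> R}) (N : nat) : Prop :=
  forall k : nat, (k < N)%N -> forall B : set T, sigma_upto eps k B ->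
    (\int[P]_(w in B) (eps k.+1 w)%:E = 0)%E.

End noise.

Section control_problem.
Context {d : measure_display} {T : measurableType d} {R : realType}.
Variable P : probability T R.

(* Only used for integrable X, so that 'E_P[X] is finite. *)
Definition mean (X : T -> R) : R := fine 'E_P[X].

Variables (p N : nat) (a b q r qbar rbar : nat -> R).
Variables (x0 : {RV P >-> R}) (eps : nat -> {RV P >-> R}).

Fixpoint state (u : nat -> {RV P >-> R}) (k : nat) : T -> R :=
  if k is j.+1 then fun w => a j * state u j w + b j * u j w + eps j.+1 w
  else x0.

Lemma measurable_state (u : nat -> {RV P >-> R}) (k : nat) :
  measurable_fun setT (state u k).
Proof.
elim: k => [|k IH] /=; first exact: measurable_funPT.
apply: measurable_funD; last exact: measurable_funPT.
by apply: measurable_funD; apply: measurable_funM.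
Qed.

HB.instance Definition _ (u : nat -> {RV P >-> R}) (k : nat) :=
  @isMeasurableFun.Build _ _ T R (state u k) (@measurable_state u k).

(* u k is a Borel function of state u k which may depend on the law of
   state u k.  Integrability says that the mean of u k exists in R, i.e. that
   (mean (u k)) ^+ (2 * p) is finite. *)
Definition admissible (u : nat -> {RV P >-> R}) : Prop :=
  forall k : nat, (k < N)%N ->
    (u k : T -> R) \in Lfun P 1%E /\
    exists phi : probability R R -> R -> R,
      (forall mu, measurable_fun setT (phi mu)) /\
      forall w : T, u k w = phi (distribution P (state u k)) (state u k w).

(* Only moments occur, so this is not random.  The variance of an integrable,
   not square-integrable variable is +oo. *)
Definition loss (u : nat -> {RV P >-> R}) : \bar R :=
  ((q N)%:E * 'V_P[state u N] + (qbar N * mean (state u N) ^+ (2 * p))%:E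
   + \sum_(0 <= k < N)
       ((q k)%:E * 'V_P[state u k] + (qbar k * mean (state u k) ^+ (2 * p))%:E
        + (r k)%:E * 'V_P[u k] + (rbar k * mean (u k) ^+ (2 * p))%:E))%E.

Definition expected_cost (u : nat -> {RV P >-> R}) : \bar R :=
  (\int[P]_w loss u)%E.

Definition optimal (u : nat -> {RV P >-> R}) : Prop :=
  admissible u /\
  forall v : nat -> {RV P >-> R}, admissible v ->
    (expected_cost u <= expected_cost v)%E.

End control_problem.

Section gains.
Context {R : realType}.

Definition dev_gain (a b r alpha : nat -> R) (k : nat) : R :=
  alpha k.+1 * b k * a k / (r k + alpha k.+1 * b k ^+ 2).

Definition mean_gain (p : nat) (a b rbar alphabar : nat -> R) (k : nat) : R :=
  let c := odd_root (2 * p - 1) (alphabar k.+1 * b k / rbar k) in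
  c * a k / (1 + c * b k).

End gains.

(* Main.v *)
Require Import Defs.
From mathcomp Require Import all_boot all_order all_algebra.
From mathcomp Require Import all_classical all_reals all_analysis.
From HB Require Import structures.
From mathcomp Require Import measurable_realfun ring lra.

Set Implicit Arguments.
Unset Strict Implicit.
Unset Printing Implicit Defensive.

Import Order.TTheory GRing.Theory Num.Theory.
Import numFieldNormedType.Exports.

Local Open Scope classical_set_scope.
Local Open Scope ring_scope.

(** The cost depends on the control only through means and variances, and the
    two separate.  The means obey the deterministic dynamics
    [m (k+1) = a m k + b E(u k)].  For the variances, the noise [eps (k+1)] is
    uncorrelated with [a x k + b u k], so
    [V(x (k+1)) = V(a x k + b u k) + E(eps (k+1) ^ 2)].

    Uncorrelatedness is the measure-theoretic core ([known_ortho_eps]).  State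
    feedback makes [x k] and [u k] functions of [x0, eps 0, ..., eps k].  On the
    generating events [A `&` B], with [A] an event of [x0] and [B] of the past
    noise, the integral of [eps (k+1)] is zero by independence and the martingale
    difference property; the pi-lambda theorem extends this to the whole
    history ([sigma_integral_eq0]), and approximation by simple functions extends
    it from events to functions ([integralM_eq0]).

    Optimality is then dynamic programming.  With the value function
    [alpha V(x k) + alphabar (m k)^(2p) + gammabar], the identity [value_step]
    says that stage cost plus next value equals the value plus a gap.  The gap is
    the sum of [(r + alpha b^2) V(u k + K x k)], obtained by completing the
    square, and of a mean part, nonnegative because even powers lie above their
    tangents ([even_power_tangent]) and the odd root in the gain solves the
    first-order condition ([mean_gain_foc]).  Summing over time, the cost is a
    constant plus the sum of the gaps ([loss_value]).  The feedback law makes all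
    gaps zero, so it is optimal; conversely an optimal control of finite cost
    has zero gaps, and a zero gap forces the feedback law almost surely
    ([gap_eq0_ae]).  When a variance is infinite the cost is infinite, which is
    why finiteness of the cost gives all the square integrability that the
    identities require ([loss_lty_L2]). *)

(** * Even powers and the mean part of the problem *)

Section scalar.
Context {R : realType}.
Implicit Types x y : R.

(** The graph of an even power lies strictly above its tangent at any other
    point.  Elementary, without derivatives: if [D n] is the gap between the
    graph and the tangent for exponent [2n+2], then
    [D (n+1) = y^2 D n + (x^(2n+2) - y^(2n+2)) (x^2 - y^2) + y^(2n+2) (x - y)^2],
    and all three terms are nonnegative. *)
Lemma even_power_tangent n x y : x != y ->
  y ^+ n.*2.+2 + (y ^+ n.*2.+1 * (x - y)) *+ n.*2.+2 < x ^+ n.*2.+2.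
Proof.
move=> xy; rewrite -subr_gt0.
elim: n => [|n IH].
  rewrite double0 (_ : _ - _ = (x - y) ^+ 2); last by rewrite -mulr_natl; ring.
  by rewrite exprn_even_gt0 // subr_eq0 xy orbT.
have [y0|y0] := eqVneq y 0.
  (* The last term of the recurrence vanishes when y = 0. *)
  rewrite y0 in xy *.
  rewrite !exprS !mul0r mul0rn addr0 subr0 -!exprS.
  by rewrite exprn_even_gt0 //= ?odd_double // xy.
(* X, Y and m stand for [x^(2n)], [y^(2n)] and [2n]. *)
have step (X Y m : R) :
    x ^+ 4 * X - (y ^+ 4 * Y + (m + 4) * (y ^+ 3 * Y * (x - y))) =
    y ^+ 2 * (x ^+ 2 * X - (y ^+ 2 * Y + (m + 2) * (y * Y * (x - y))))
    + (x ^+ 2 * X - y ^+ 2 * Y) * (x ^+ 2 - y ^+ 2)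
    + y ^+ 2 * Y * (x - y) ^+ 2 by ring.
have SD m (z : R) j : z ^+ (m + j) = z ^+ j * z ^+ m by rewrite addnC exprD.
have -> : x ^+ n.+1.*2.+2 -
    (y ^+ n.+1.*2.+2 + (y ^+ n.+1.*2.+1 * (x - y)) *+ n.+1.*2.+2) =
   y ^+ 2 * (x ^+ n.*2.+2
     - (y ^+ n.*2.+2 + (y ^+ n.*2.+1 * (x - y)) *+ n.*2.+2))
   + (x ^+ n.*2.+2 - y ^+ n.*2.+2) * (x ^+ 2 - y ^+ 2)
   + y ^+ n.*2.+2 * (x - y) ^+ 2.
  rewrite doubleS; move: (n.*2) => j.
  rewrite -(mulr_natl _ j.+4) -(mulr_natl _ j.+2).
  have -> : j.+4 = (j + 4)%N by rewrite addn4.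
  have -> : j.+3 = (j + 3)%N by rewrite addn3.
  have -> : j.+2 = (j + 2)%N by rewrite addn2.
  have -> : j.+1 = (j + 1)%N by rewrite addn1.
  by rewrite !SD !natrD expr1 step.
have mono : 0 <= (x ^+ n.*2.+2 - y ^+ n.*2.+2) * (x ^+ 2 - y ^+ 2).
  rewrite -doubleS -muln2 mulnC !exprM.
  have [xy2|/ltW xy2] := leP (x ^+ 2) (y ^+ 2).
    by rewrite mulr_le0 // subr_le0 // lerXn2r // nnegrE sqr_ge0.
  by rewrite mulr_ge0 // subr_ge0 // lerXn2r // nnegrE sqr_ge0.
apply: ltr_wpDl; first by rewrite addr_ge0 // mulr_ge0 ?sqr_ge0 // ltW.
by apply: mulr_gt0; rewrite // exprn_even_gt0 //= ?odd_double ?y0 ?orbT //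
  subr_eq0 xy.
Qed.

Lemma odd_rootK m x : odd m -> odd_root m x ^+ m = x.
Proof.
move=> om; have m0 : (0 < m)%N by case: m om.
rewrite /odd_root exprMn -[X in _ * X]powR_mulrn ?powR_ge0 // -powRrM.
rewrite mulVf ?pnatr_eq0 -?lt0n //.
rewrite powRr1 // [RHS]numEsg; congr (_ * _).
by case: (sgrP x) => _; rewrite ?expr1n ?expr0n ?gtn_eqF // -signr_odd om.
Qed.

Lemma odd_root_mul_ge0 m x b : 0 <= x * b -> 0 <= odd_root m x * b.
Proof.
move=> xb; rewrite /odd_root mulrAC mulr_ge0 ?powR_ge0 //.
by move: xb; case: (sgrP x); nra.
Qed.

Section mean_step.
Variables (p : nat) (a b rbar alphabar : nat -> R) (k : nat).
Hypothesis p1 : (1 <= p)%N.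
Hypothesis rbar_gt0 : 0 < rbar k.
Hypothesis alphabar_gt0 : 0 < alphabar k.+1.

Let K := mean_gain p a b rbar alphabar k.
Let c := odd_root (2 * p - 1) (alphabar k.+1 * b k / rbar k).

(** What the choice [v] of the mean of the control costs in excess of the
    minimum, when the mean of the state is [m] and the mean cost-to-go of the
    next state is [alphabar k.+1] times its [2p]-th power. *)
Definition mean_gap (m v : R) : R :=
  rbar k * v ^+ (2 * p) + alphabar k.+1 * (a k * m + b k * v) ^+ (2 * p)
  - (rbar k * K ^+ (2 * p) + alphabar k.+1 * (a k - b k * K) ^+ (2 * p))
    * m ^+ (2 * p).

Lemma mean_gap_opt m : mean_gap m (- K * m) = 0.
Proof.
rewrite /mean_gap (_ : _ + b k * _ = (a k - b k * K) * m); last by ring.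
have -> : - K * m = - (K * m) by ring.
by rewrite [(- _) ^+ _]exprM sqrrN -exprM !exprMn; ring.
Qed.

(** The first-order condition for the minimum over [v] of
    [rbar v^(2p) + alphabar (a m + b v)^(2p)], up to the factor [2p].  With
    [c] the odd root in the gain, [a - b K = a / (1 + c b)], so the optimal
    [v = - K m] equals [- c] times the resulting mean, and [c ^ (2p-1)] is
    exactly [alphabar b / rbar].  The denominator does not vanish because [c]
    has the sign of [b]. *)
Lemma mean_gain_foc m :
  rbar k * (- K * m) ^+ (2 * p - 1)
  + alphabar k.+1 * b k * ((a k - b k * K) * m) ^+ (2 * p - 1) = 0.
Proof.
have odp : odd (2 * p - 1) by rewrite oddB ?muln_gt0 // oddM.
have cb0 : 0 <= c * b k.
  apply: odd_root_mul_ge0; rewrite mulrAC divr_ge0 ?(ltW rbar_gt0) //.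
  by rewrite -mulrA mulr_ge0 ?(ltW alphabar_gt0) // -expr2 sqr_ge0.
have cb1 : 1 + c * b k != 0 by rewrite gt_eqF // ltr_pwDl.
have -> : - K * m = - c * ((a k - b k * K) * m).
  by rewrite /K /mean_gain -/c; field.
rewrite exprMn exprNn -signr_odd odp expr1 odd_rootK //.
by field; rewrite gt_eqF.
Qed.

(** Add the tangent inequalities for the two even powers at the critical
    point: by the first-order condition their linear parts cancel.  Strictness
    comes from the control term, since [rbar] is positive. *)
Lemma mean_gap_gt0 m v : v != - K * m -> 0 < mean_gap m v.
Proof.
move=> vK; have E := mean_gain_foc m.
set w := - K * m in vK E *.
have -> : mean_gap m v =
    (rbar k * v ^+ (2 * p) - rbar k * w ^+ (2 * p))
    + (alphabar k.+1 * (a k * m + b k * v) ^+ (2 * p)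
       - alphabar k.+1 * (a k * m + b k * w) ^+ (2 * p)).
  by rewrite -[LHS]subr0 -[X in _ - X](mean_gap_opt m) /mean_gap -/w; ring.
rewrite (_ : (a k - b k * K) * m = a k * m + b k * w) in E; last first.
  by rewrite /w; ring.
case: p p1 E => // n _; rewrite mulnC muln2 doubleS subn1 /= => E.
set X := a k * m + b k * v; set Y := a k * m + b k * w in E *.
have T1 := even_power_tangent n vK.
have T2 : Y ^+ n.*2.+2 + (Y ^+ n.*2.+1 * (X - Y)) *+ n.*2.+2 <= X ^+ n.*2.+2.
  have [->|/even_power_tangent/ltW//] := eqVneq X Y.
  by rewrite subrr mulr0 mul0rn addr0.
rewrite -mulr_natl in T1; rewrite -mulr_natl in T2.
rewrite -(ltr_pM2l rbar_gt0) in T1; rewrite -(ler_pM2l alphabar_gt0) in T2.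
have XY : X - Y = b k * (v - w) by rewrite /X /Y; ring.
rewrite XY in T2.
have E2 : n.*2.+2%:R * (v - w) * (rbar k * w ^+ n.*2.+1 +
      alphabar k.+1 * b k * Y ^+ n.*2.+1) = 0 by rewrite E mulr0.
lra.
Qed.

Lemma mean_gap_ge0 m v : 0 <= mean_gap m v.
Proof.
by have [->|/mean_gap_gt0/ltW//] := eqVneq v (- K * m); rewrite mean_gap_opt.
Qed.

End mean_step.
End scalar.

(** * Integrals against functions of given events *)

Section integral_against_preimages.
Context {d : measure_display} {T : measurableType d} {R : realType}.
Variable mu : {measure set T -> \bar R}.
Import HBNNSimple.
Implicit Types f g : T -> R.

Lemma indic_mul_restrict (A : set T) g :
  (fun x => (\1_A x * g x)%:E) = (EFin \o g) \_ A.
Proof.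
apply/funext => x; rewrite patchE indicE.
by case: ifPn => _ /=; rewrite ?mul1r ?mul0r.
Qed.

Lemma integral_indicM (A : set T) g :
  (\int[mu]_x (\1_A x * g x)%:E = \int[mu]_(x in A) (g x)%:E)%E.
Proof. by rewrite [RHS]integral_mkcond -indic_mul_restrict. Qed.

Lemma integrable_indicM (A : set T) g : measurable A ->
  mu.-integrable setT (EFin \o g) ->
  mu.-integrable setT (fun x => (\1_A x * g x)%:E).
Proof.
move=> mA ig; rewrite indic_mul_restrict -integrable_mkcond //.
exact: integrableS ig.
Qed.

(** If [g] integrates to zero over every event determined by [f], then [g] is
    orthogonal to [f].  Simple functions [h n] increasing to the identity of
    the half line are composed with [f], so that the level sets of [h n \o f]
    are preimages of Borel sets; dominated convergence, with bound [|f g|],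
    passes to the limit. *)
Lemma ge0_integralM_eq0 f g :
  measurable_fun setT f -> (forall x, 0 <= f x) ->
  mu.-integrable setT (EFin \o g) ->
  mu.-integrable setT (EFin \o (f \* g)) ->
  (forall C : set R, measurable C ->
     \int[mu]_(x in f @^-1` C) (g x)%:E = 0)%E ->
  (\int[mu]_x (f x * g x)%:E = 0)%E.
Proof.
move=> mf f0 ig ifg fg0.
have mE : measurable_fun [set y : R | 0 <= y] (fun y : R => y%:E).
  by apply: measurable_funTS; exact/measurable_EFinP.
have mD : measurable [set y : R | 0 <= y].
  by rewrite -[X in measurable X]set_itvcy; exact: measurable_itv.
pose h := nnsfun_approx mD mE.
have h0 n y : 0 <= y -> 0 <= h n y <= y.
  move=> y0; rewrite fun_ge0 /= -lee_fin /h nnsfun_approxE.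
  by apply: (@le_approx _ _ _ [set y : R | 0 <= y] (fun y : R => y%:E)).
have hg0 n : (\int[mu]_x (h n (f x) * g x)%:E = 0)%E.
  have mA y : measurable (f @^-1` (h n @^-1` [set y])).
    by rewrite -[X in measurable X]setTI; exact: mf.
  under eq_integral => x _.
    rewrite fimfunE fsbig_finite // mulr_suml -sumEFin.
    under eq_bigr do rewrite -mulrA EFinM.
    over.
  have int1 y : mu.-integrable setT
      (fun x => y%:E * (\1_(h n @^-1` [set y]) (f x) * g x)%:E)%E.
    exact/(integrableZl measurableT)/(integrable_indicM (mA y) ig).
  rewrite integral_sum // big1 // => y _.
  rewrite integralZl //; last exact: (integrable_indicM (mA y) ig).
  rewrite (_ : (fun x => _) =
    (fun x => (\1_(f @^-1` (h n @^-1` [set y])) x * g x)%:E)) //.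
  by rewrite integral_indicM fg0 ?mule0.
have [_ _] : [/\ mu.-integrable setT (fun x => (f x * g x)%:E),
  [sequence \int[mu]_x
     (`|(h n (f x) * g x)%:E - (f x * g x)%:E|)%E]_n @ \oo --> 0%E &
  [sequence \int[mu]_x (h n (f x) * g x)%:E]_n @ \oo
     --> \int[mu]_x (f x * g x)%:E]%E.
  have mg : measurable_fun setT g by apply/measurable_EFinP; case/integrableP: ig.
  apply: (dominated_convergence _ _ _ _ (integrable_abse ifg)) => //.
  - move=> n; apply/measurable_EFinP/measurable_funM => //.
    exact: measurableT_comp.
  - exact/measurable_EFinP/measurable_funM.
  - apply/nearW => x _; under eq_fun do rewrite EFinM.
    rewrite EFinM; apply: cvgeZr => //.
    by apply: (@cvg_nnsfun_approx _ _ _ [set y : R | 0 <= y] _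
      (fun y : R => y%:E)); [|exact: f0].
  - apply/nearW => x n _ /=; rewrite lee_fin !normrM ler_wpM2r //.
    by have /andP[h1 h2] := h0 n _ (f0 x); rewrite !ger0_norm.
rewrite (_ : [sequence _]_n = cst 0%E); last by apply/funext => n /=; rewrite hg0.
by move=> /cvg_lim <- //; rewrite lim_cst.
Qed.

(** The signed case: the positive and negative parts of [f] are Borel functions
    of [f], so they determine no further events. *)
Lemma integralM_eq0 f g :
  measurable_fun setT f ->
  mu.-integrable setT (EFin \o g) ->
  mu.-integrable setT (EFin \o (f \* g)) ->
  (forall C : set R, measurable C ->
     \int[mu]_(x in f @^-1` C) (g x)%:E = 0)%E ->
  (\int[mu]_x (f x * g x)%:E = 0)%E.
Proof.
move=> mf ig ifg fg0.
have part (phi : R -> R) : measurable_fun setT phi ->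
    (forall y, 0 <= phi y <= `|y|) ->
    mu.-integrable setT (fun x => (phi (f x) * g x)%:E) /\
    (\int[mu]_x (phi (f x) * g x)%:E = 0)%E.
  move=> mphi phi_le.
  have mg : measurable_fun setT g by apply/measurable_EFinP; case/integrableP: ig.
  have mpf : measurable_fun setT (phi \o f) by exact: measurableT_comp.
  have ipfg : mu.-integrable setT (EFin \o ((phi \o f) \* g)).
    apply: le_integrable ifg => //.
      by apply/measurable_EFinP; apply: (measurable_funM mpf mg).
    move=> x _ /=; rewrite lee_fin !normrM ler_wpM2r //.
    by have /andP[h1 h2] := phi_le (f x); rewrite ger0_norm.
  split => //; apply: (@ge0_integralM_eq0 (phi \o f)) => //.
    by move=> x; have /andP[] := phi_le (f x).
  move=> C mC; rewrite comp_preimage; apply: fg0.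
  by rewrite -[X in measurable X]setTI; exact: mphi.
have m1 : measurable_fun setT (fun y : R => Num.max y 0).
  exact: measurable_maxr.
have m2 : measurable_fun setT (fun y : R => Num.max (- y) 0).
  exact: measurable_maxr.
have max_norm (y : R) : 0 <= Num.max y 0 <= `|y|.
  by rewrite le_max lexx orbT ge_max ler_norm normr_ge0.
have [i1 e1] := part _ m1 max_norm.
have max_normN (y : R) : 0 <= Num.max (- y) 0 <= `|y|.
  by rewrite -normrN max_norm.
have [i2 e2] := part _ m2 max_normN.
transitivity (\int[mu]_x ((Num.max (f x) 0 * g x)%:E
                          - (Num.max (- f x) 0 * g x)%:E))%E.
  apply: eq_integral => x _; rewrite -EFinB -mulrBl; congr (_ * _)%:E.
  by case: (leP (f x) 0) => h; case: (leP (- f x) 0); lra.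
by rewrite integralB // e1 e2 sube0.
Qed.

Lemma dynkin_integral_eq0 (g : T -> R) :
  mu.-integrable setT (EFin \o g) -> (\int[mu]_x (g x)%:E = 0)%E ->
  dynkin [set S | measurable S /\ (\int[mu]_(x in S) (g x)%:E = 0)%E].
Proof.
move=> ig g0; split => [//|S [mS S0]|F tF F0].
- split; first exact: measurableC.
  rewrite -integral_indicM.
  transitivity (\int[mu]_x ((g x)%:E - (\1_S x * g x)%:E))%E.
    apply: eq_integral => x _; rewrite -EFinB; congr EFin.
    rewrite !indicE in_setC; case: (x \in S); rewrite /= ?mul1r ?mul0r; lra.
  rewrite integralB ?integral_indicM ?g0 ?S0 ?sube0 //.
  exact: integrable_indicM.
- have mF k : measurable (F k) by case: (F0 k).
  split; first exact: bigcup_measurable.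
  rewrite integral_bigcup //; last first.
    by apply: integrableS ig => //; exact: bigcup_measurable.
  by rewrite eseries0 // => k _ _; case: (F0 k).
Qed.

(** The pi-lambda theorem: it is enough to test a zero integral on a generating
    family closed under intersection. *)
Lemma sigma_integral_eq0 (G : set (set T)) (g : T -> R) :
  mu.-integrable setT (EFin \o g) -> (\int[mu]_x (g x)%:E = 0)%E ->
  setI_closed G ->
  (forall S, G S -> measurable S /\ (\int[mu]_(x in S) (g x)%:E = 0)%E) ->
  forall S, <<s G >> S -> measurable S /\ (\int[mu]_(x in S) (g x)%:E = 0)%E.
Proof.
move=> ig g0 GI Gg S; rewrite -setI_closed_g_dynkin_g_sigma_algebra //.
by move=> /(_ _ (conj (dynkin_integral_eq0 ig g0) Gg)).
Qed.

End integral_against_preimages.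

(** * The noise is orthogonal to the past *)

Section generated.
Context {T : pointedType}.
Implicit Type G : set (set T).

Lemma g_sigma_setT G : <<s G >> setT.
Proof. exact: (@measurableT _ (g_sigma_algebraType G)). Qed.

Lemma g_sigma_setI G : setI_closed <<s G >>.
Proof. by move=> A B; exact: (@measurableI _ (g_sigma_algebraType G)). Qed.

End generated.

Section noise_history.
Context {d : measure_display} {T : measurableType d} {R : realType}.
Variables (P : probability T R) (x0 : {RV P >-> R}) (eps : nat -> {RV P >-> R}).

(** A pi-system that generates the sigma-algebra of [x0, eps 0, ..., eps k];
    intersections of two independent factors are kept apart so that the
    independence of [x0] and the noise can be used on the generators. *)
Definition history_base (k : nat) : set (set T) :=
  [set S | exists A B, [/\ sigma_rv x0 A, sigma_upto eps k B & S = A `&` B]].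

(** [f] is a function of [x0, eps 0, ..., eps k]. *)
Definition known_at (k : nat) (f : T -> R) : Prop :=
  measurable_fun [set: g_sigma_algebraType (history_base k)] f.

Lemma sigma_rv_measurable A : sigma_rv x0 A -> measurable A.
Proof.
apply: smallest_sub; first exact: sigma_algebra_measurable.
move=> _ [C mC ->]; rewrite -[X in measurable X]setTI; exact: measurable_funPT.
Qed.

Lemma sigma_upto_measurable k B : sigma_upto eps k B -> measurable B.
Proof.
apply: smallest_sub; first exact: sigma_algebra_measurable.
move=> _ [j [_ [C mC ->]]]; rewrite -[X in measurable X]setTI.
exact: measurable_funPT.
Qed.

Lemma sigma_uptoS k N : (k <= N)%N -> sigma_upto eps k `<=` sigma_upto eps N.
Proof.
move=> kN; apply: sub_smallest2r; first exact: smallest_sigma_algebra.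
move=> _ [j [jk [C mC ->]]]; exists j; split; first exact: leq_trans kN.
by exists C.
Qed.

Lemma sigma_upto_eps j k (C : set R) : (j <= k)%N -> measurable C ->
  sigma_upto eps k (eps j @^-1` C).
Proof.
by move=> jk mC; apply: sub_sigma_algebra; exists j; split => //; exists C.
Qed.

Lemma history_baseI k : setI_closed (history_base k).
Proof.
move=> _ _ [A1 [B1 [sA1 sB1 ->]]] [A2 [B2 [sA2 sB2 ->]]].
exists (A1 `&` A2), (B1 `&` B2); split; last by rewrite setIACA.
- exact: g_sigma_setI.
- exact: g_sigma_setI.
Qed.

Lemma known_x0 k : known_at k x0.
Proof.
move=> _ C mC; rewrite setTI; apply: sub_sigma_algebra.
exists (x0 @^-1` C), setT; split; last by rewrite setIT.
  by apply: sub_sigma_algebra; exists C.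
exact: g_sigma_setT.
Qed.

Lemma known_eps k : known_at k (eps k).
Proof.
move=> _ C mC; rewrite setTI; apply: sub_sigma_algebra.
exists setT, (eps k @^-1` C); split; last by rewrite setTI.
  exact: g_sigma_setT.
exact: sigma_upto_eps.
Qed.

Lemma known_atS k f : known_at k f -> known_at k.+1 f.
Proof.
move=> kf _ C mC; have := kf measurableT C mC; apply: sub_smallest2r.
  exact: smallest_sigma_algebra.
move=> _ [A [B [sA sB ->]]]; exists A, B; split => //.
exact: (sigma_uptoS (leqnSn k)).
Qed.

Variable N : nat.
Hypothesis x0_eps_indep : indep_rv_process x0 eps N.
Hypothesis eps_L1 : forall k, (k <= N)%N -> P.-integrable setT (EFin \o eps k).
Hypothesis eps_past : zero_mean_given_past eps N.

(** By independence the integral over [A `&` B] is [P A] times the integral over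
    [B], which is zero.  The factorisation is itself an instance of
    orthogonality: [\1_A - P A] integrates to zero over every event of the noise,
    hence is orthogonal to [\1_B * eps k.+1], a function of the noise. *)
Lemma integral_eps_history_base k S : (k < N)%N -> history_base k S ->
  measurable S /\ (\int[P]_(w in S) (eps k.+1 w)%:E = 0)%E.
Proof.
move=> kN [A [B [sA sB ->]]].
have mA := sigma_rv_measurable sA; have mB := sigma_upto_measurable sB.
split; first exact: measurableI.
have iB := integrable_indicM mB (eps_L1 kN).
pose pA := fine (P A).
have PA : P A = pA%:E by rewrite fineK // fin_num_measure.
have i1A : P.-integrable setT (EFin \o \1_A) by exact: integrable_indic.
have icst : P.-integrable setT (EFin \o cst pA).
  exact: finite_measure_integrable_cst.
pose f w := \1_B w * eps k.+1 w.
pose g w := \1_A w - pA.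
have fgE w : (f w * g w)%:E =
    ((\1_(A `&` B) w * eps k.+1 w)%:E - pA%:E * (f w)%:E)%E.
  by rewrite -EFinM -EFinB /f /g indicI; congr EFin; rewrite /=; ring.
have iAB := integrable_indicM (measurableI _ _ mA mB) (eps_L1 kN).
have ipf : P.-integrable setT (fun w => pA%:E * (f w)%:E)%E.
  exact: integrableZl.
have : (\int[P]_w (f w * g w)%:E = 0)%E.
  apply: integralM_eq0.
  - by apply/measurable_EFinP; case/integrableP: iB.
  - rewrite (_ : EFin \o g = (EFin \o \1_A) \- (EFin \o cst pA))%E //.
    exact: integrableB.
  - rewrite (_ : EFin \o (f \* g)%R =
      (fun w => (\1_(A `&` B) w * eps k.+1 w)%:E)
      \- (fun w => pA%:E * (f w)%:E))%E.
      exact: integrableB.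
    by apply/funext => w; exact: fgE.
  - move=> C mC.
    have sC : sigma_upto eps N (f @^-1` C).
      rewrite -[X in sigma_upto _ _ X]setTI.
      pose S0 := [set A | exists j : nat, (j <= N)%N /\
         exists2 C : set R, measurable C & A = eps j @^-1` C].
      suff mf : measurable_fun [set: g_sigma_algebraType S0] f by exact: mf.
      apply: measurable_funM.
        apply: measurable_indic; exact: (sigma_uptoS (ltnW kN)).
      by move=> _ D mD; rewrite setTI; exact: sigma_upto_eps.
    have mC' := sigma_upto_measurable sC.
    under eq_integral do rewrite EFinB.
    rewrite integralB //; last 2 first.
    - exact: (integrableS measurableT).
    - exact: (integrableS measurableT).
    rewrite integral_indic // integral_cst //.
    have /= indepAC := x0_eps_indep sA sC.
    rewrite -PA (_ : P (A `&` _) = P A * P (f @^-1` C))%E //.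
    by rewrite subee // fin_numM // fin_num_measure.
under eq_integral do rewrite fgE.
rewrite integralB // integralZl // integral_indicM integral_indicM (eps_past kN sB).
by rewrite mule0 sube0.
Qed.

(** The next noise term is orthogonal to everything known at time [k], although
    [x0] and the past noise need not be square integrable. *)
Lemma known_ortho_eps k f : (k < N)%N -> known_at k f ->
  measurable_fun setT f ->
  P.-integrable setT (EFin \o (f \* eps k.+1)) ->
  (\int[P]_w (f w * eps k.+1 w)%:E = 0)%E.
Proof.
move=> kN kf mf ife; apply: integralM_eq0 => //; first exact: eps_L1.
move=> C mC.
have e0 : (\int[P]_w (eps k.+1 w)%:E = 0)%E.
  apply: eps_past => //; exact: g_sigma_setT.
have := kf measurableT C mC; rewrite setTI => sC.
have [|_ //] := sigma_integral_eq0 (eps_L1 kN) e0 (@history_baseI k) _ sC.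
by move=> S; exact: integral_eps_history_base.
Qed.

End noise_history.

(** * Means and variances of square integrable variables *)

Section square_integrable.
Context {d : measure_display} {T : measurableType d} {R : realType}.
Variable P : probability T R.
Implicit Types X Y Z : T -> R.

Lemma Lfun12 X : X \in Lfun P 2%:E -> X \in Lfun P 1%E.
Proof. by apply: Lfun_subset12; exact: fin_num_measure. Qed.

Lemma Lfun_measurable X r : X \in Lfun P r -> measurable_fun setT X.
Proof. by move=> /sub_Lfun_mfun; rewrite inE. Qed.

Lemma integrable_sqr_Lfun2 X : measurable_fun setT X ->
  P.-integrable setT (EFin \o (fun w => X w ^+ 2)) -> X \in Lfun P 2%:E.
Proof.
move=> mX /integrableP[_ X2].
rewrite inE; apply/andP; split; rewrite inE //=.
rewrite /finite_norm unlock poweR_lty //; apply: le_lt_trans X2.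
rewrite le_eqVlt; apply/orP; left; apply/eqP; apply: eq_integral => w _ /=.
by rewrite powR_mulrn // normrX.
Qed.

Lemma Lfun_lin X Y c e r : 1 <= r -> X \in Lfun P r%:E -> Y \in Lfun P r%:E ->
  (fun w => c * X w + e * Y w) \in Lfun P r%:E.
Proof.
move=> r1 LX LY.
rewrite (_ : (fun w => _) = (c \o* X) \+ (e \o* Y)).
  by apply: rpredD; apply: Lfun_scale.
by apply/funext => w /=; rewrite [c * _]mulrC [e * _]mulrC.
Qed.

Lemma variance_integral X :
  ('V_P[X] = \int[P]_w ((X w - mean P X) ^+ 2)%:E)%E.
Proof.
rewrite /variance unlock -/(mean P X); move: (mean P X) => m.
by rewrite unlock; apply: eq_integral => w _; rewrite expr2.
Qed.

(** The variance of an integrable variable is an integral of squares, possibly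
    infinite; when it is finite the variable is square integrable. *)
Lemma variance_lty_Lfun2 X : X \in Lfun P 1%E -> ('V_P[X] < +oo)%E ->
  X \in Lfun P 2%:E.
Proof.
move=> X1; set m := mean P X => VX.
have mX := Lfun_measurable X1.
have mXc : measurable_fun setT (fun w => X w - m) by exact: measurable_funB.
have -> : X = (fun w => X w - m) \+ cst m.
  by apply/funext => w /=; rewrite subrK.
apply: rpredD; [exact: lee1n| |by move=> ?; exact: Lfun_cst].
move=> p1.
apply: integrable_sqr_Lfun2 => //; apply/integrableP; split.
  by apply/measurable_EFinP; exact: measurable_funX.
move: VX; rewrite variance_integral; apply: le_lt_trans.
rewrite le_eqVlt; apply/orP; left; apply/eqP; apply: eq_integral => w _ /=.
by rewrite ger0_norm ?sqr_ge0.
Qed.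

Lemma variance_eq0_ae X : X \in Lfun P 2%:E -> ('V_P[X] = 0)%E ->
  {ae P, forall w, X w = mean P X}.
Proof.
move=> X2; have mX := Lfun_measurable X2.
rewrite variance_integral => V0.
have mXc : measurable_fun setT (fun w => (X w - mean P X) ^+ 2).
  by apply: measurable_funX; exact: measurable_funB.
have : (\int[P]_w `|((X w - mean P X) ^+ 2)%:E| = 0)%E.
  rewrite -[RHS]V0; apply: eq_integral => w _ /=.
  by rewrite ger0_norm ?sqr_ge0.
move=> /(ae_eq_integral_abs P measurableT).
move=> /(_ (proj2 (measurable_EFinP _ _) mXc)).
apply: filterS => w /(_ I) /= [] /eqP.
by rewrite sqrf_eq0 subr_eq0 => /eqP.
Qed.

Lemma mean_lin X Y c e : X \in Lfun P 1%E -> Y \in Lfun P 1%E ->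
  mean P (fun w => c * X w + e * Y w) = c * mean P X + e * mean P Y.
Proof.
move=> LX LY; rewrite /mean.
rewrite (_ : (fun w => _) = (c \o* X) \+ (e \o* Y)); last first.
  by apply/funext => w /=; rewrite [c * _]mulrC [e * _]mulrC.
rewrite expectationD ?Lfun_scale // !expectationZl //.
by rewrite fineD ?fin_numM ?expectation_fin_num // !fineM ?expectation_fin_num.
Qed.

Lemma variance_lin X Y c e : X \in Lfun P 2%:E -> Y \in Lfun P 2%:E ->
  ('V_P[(fun w => (c * X w + e * Y w)%R)] =
   (c ^+ 2 * fine 'V_P[X] + e ^+ 2 * fine 'V_P[Y]
    + 2 * (c * e * fine (covariance P X Y)))%:E)%E.
Proof.
move=> LX LY.
have X1 := Lfun12 LX; have Y1 := Lfun12 LY; have XY := Lfun2_mul_Lfun1 LX LY.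
have cX : (c \o* X)%R \in Lfun P 2%:E by rewrite Lfun_scale // ler1n.
have eY : (e \o* Y)%R \in Lfun P 2%:E by rewrite Lfun_scale // ler1n.
rewrite (_ : (fun w => _) = (c \o* X) \+ (e \o* Y))%R; last first.
  by apply/funext => w /=; rewrite [(c * _)%R]mulrC [(e * _)%R]mulrC.
rewrite varianceD // !varianceZ // covarianceZl //; last 2 first.
- exact: Lfun12.
- exact: Lfun2_mul_Lfun1.
rewrite covarianceZr //.
move: (variance_fin_num LX) (variance_fin_num LY) (covariance_fin_num X1 Y1 XY).
case: ('V_P[X])%E => [vX| |] // _; case: ('V_P[Y])%E => [vY| |] // _.
case: (covariance P X Y) => [cXY| |] // _ /=.
by rewrite -!EFinM -!EFinD !mulrA.
Qed.

End square_integrable.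

(** * Dynamic programming *)

Section value_function.
Context {d : measure_display} {T : measurableType d} {R : realType}.
Variables (P : probability T R) (p N : nat).
Variables (a b q r qbar rbar : nat -> R).
Variables (x0 : {RV P >-> R}) (eps : nat -> {RV P >-> R}).
Variables (alphabar gammabar alpha : nat -> R).
Hypothesis p_ge1 : (1 <= p)%N.
Hypothesis q_gt0 : forall k, (k <= N)%N -> 0 < q k.
Hypothesis qbar_gt0 : forall k, (k <= N)%N -> 0 < qbar k.
Hypothesis r_gt0 : forall k, (k < N)%N -> 0 < r k.
Hypothesis rbar_gt0 : forall k, (k < N)%N -> 0 < rbar k.
Hypothesis eps_L2 : forall k, (k <= N)%N -> (eps k : T -> R) \in Lfun P 2%:E.
Hypothesis eps_mean0 : forall k, (k <= N)%N -> ('E_P[eps k] = 0)%E.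
Hypothesis eps_past : zero_mean_given_past eps N.
Hypothesis x0_L1 : (x0 : T -> R) \in Lfun P 1%E.
Hypothesis x0_eps_indep : indep_rv_process x0 eps N.
Hypothesis alphabarN : alphabar N = qbar N.
Hypothesis gammabarN : gammabar N = 0.
Hypothesis alphaN : alpha N = q N.
Hypothesis alphabar_rec : forall k, (k < N)%N ->
  alphabar k = qbar k
    + rbar k * mean_gain p a b rbar alphabar k ^+ (2 * p)
    + alphabar k.+1
      * (a k - b k * mean_gain p a b rbar alphabar k) ^+ (2 * p).
Hypothesis gammabar_rec : forall k, (k < N)%N ->
  ((gammabar k)%:E = (gammabar k.+1)%:E
    + (alpha k.+1)%:E * 'E_P[(fun w => eps k.+1 w ^+ 2)%R])%E.
Hypothesis alpha_rec : forall k, (k < N)%N ->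
  alpha k = q k
    + r k * (alpha k.+1 * b k * a k / (r k + alpha k.+1 * b k ^+ 2)) ^+ 2
    + alpha k.+1
      * (a k - alpha k.+1 * b k ^+ 2 * a k
               / (r k + alpha k.+1 * b k ^+ 2)) ^+ 2.

Implicit Type u : nat -> {RV P >-> R}.
Local Notation x := (state a b x0 eps).
Local Notation m u k := (mean P (x u k)).
Local Notation mu_ u k := (mean P (u k)).
Local Notation admissible := (admissible N a b x0 eps).
Local Notation loss := (loss p N a b q r qbar rbar x0 eps).
Local Notation K := (dev_gain a b r alpha).
Local Notation Kbar := (mean_gain p a b rbar alphabar).

Lemma alpha_gt0 k : (k <= N)%N -> 0 < alpha k.
Proof.
move=> kN; rewrite -(subKn kN); elim: (N - k)%N (leq_subr k N) => [|j IH] jN.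
  by rewrite subn0 alphaN q_gt0.
have jN' : (N - j.+1 < N)%N by rewrite ltn_subrL; case: N jN.
have Ej : (N - j.+1).+1 = (N - j)%N by rewrite -subSn.
have {}IH := IH (ltnW jN).
rewrite alpha_rec // Ej -addrA ltr_pwDl ?q_gt0 ?leq_subr //.
by rewrite addr_ge0 // mulr_ge0 ?sqr_ge0 // ltW ?r_gt0.
Qed.

Lemma alphabar_gt0 k : (k <= N)%N -> 0 < alphabar k.
Proof.
move=> kN; rewrite -(subKn kN); elim: (N - k)%N (leq_subr k N) => [|j IH] jN.
  by rewrite subn0 alphabarN qbar_gt0.
have jN' : (N - j.+1 < N)%N by rewrite ltn_subrL; case: N jN.
have Ej : (N - j.+1).+1 = (N - j)%N by rewrite -subSn.
have {}IH := IH (ltnW jN).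
have even_ge0 (z : R) : 0 <= z ^+ (2 * p) by rewrite exprM exprn_ge0 ?sqr_ge0.
rewrite alphabar_rec // Ej -addrA ltr_pwDl ?qbar_gt0 ?leq_subr //.
by rewrite addr_ge0 // mulr_ge0 // ltW ?rbar_gt0.
Qed.

Lemma eps_L1 k : (k <= N)%N -> (eps k : T -> R) \in Lfun P 1%E.
Proof. by move=> kN; apply/Lfun12/eps_L2. Qed.

Lemma state_L1 u k : (forall j, (j < N)%N -> (u j : T -> R) \in Lfun P 1%E) ->
  (k <= N)%N -> x u k \in Lfun P 1%E.
Proof.
move=> uL1; elim: k => [//|k IH] kN /=.
have xk := IH (ltnW kN).
by apply: rpredD => //; [exact: Lfun_lin (uL1 _ kN)|exact: eps_L1].
Qed.

Lemma mean_state u k : (forall j, (j < N)%N -> (u j : T -> R) \in Lfun P 1%E) ->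
  (k < N)%N -> m u k.+1 = a k * m u k + b k * mu_ u k.
Proof.
move=> uL1 kN.
have xk := state_L1 uL1 (ltnW kN).
rewrite -mean_lin ?uL1 // /mean /=.
set Y := fun w => a k * x u k w + _.
have YL1 : Y \in Lfun P 1%E by apply: Lfun_lin => //; exact: uL1.
rewrite (_ : (fun w => _) = Y \+ eps k.+1) //.
by rewrite expectationD ?eps_L1 // eps_mean0 // adde0.
Qed.

Lemma state_L2 u k :
  (x0 : T -> R) \in Lfun P 2%:E ->
  (forall j, (j < k)%N -> (u j : T -> R) \in Lfun P 2%:E) ->
  (k <= N)%N -> x u k \in Lfun P 2%:E.
Proof.
move=> x0L2; elim: k => [//|k IH] uL2 kN /=.
have xk := IH (fun j jk => uL2 j (leqW jk)) (ltnW kN).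
have uk := uL2 k (ltnSn k).
have YL2 : (fun w => a k * x u k w + b k * u k w) \in Lfun P 2%:E.
  by apply: Lfun_lin => //; rewrite ler1n.
apply: rpredD => [|?|?]; [exact: lee1n|exact: YL2|exact: eps_L2].
Qed.

(** State feedback is where admissibility matters: the control may use the
    state only, hence nothing that is not yet known. *)
Lemma known_feedback u k : admissible u -> (k < N)%N ->
  known_at x0 eps k (x u k) -> known_at x0 eps k (u k).
Proof.
move=> adm kN kx; have [_ [phi [mphi uE]]] := adm k kN.
rewrite (_ : (u k : T -> R) = phi (distribution P (x u k)) \o x u k).
  exact: measurableT_comp.
by apply/funext => w; rewrite /= uE.
Qed.

Lemma known_state u k : admissible u -> (k <= N)%N -> known_at x0 eps k (x u k).
Proof.
move=> adm; elim: k => [|k IH] kN /=; first exact: known_x0.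
have kx := IH (ltnW kN); have ku := known_feedback adm kN kx.
apply: measurable_funD; last exact: known_eps.
apply: known_atS; apply: measurable_funD; exact: measurable_funM.
Qed.

(** The dynamics separate the noise: its covariance with the part of the next
    state that is known at time [k] vanishes. *)
Lemma variance_state u k : admissible u -> (k < N)%N ->
  x u k \in Lfun P 2%:E -> (u k : T -> R) \in Lfun P 2%:E ->
  ('V_P[x u k.+1] = 'V_P[(fun w => (a k * x u k w + b k * u k w)%R)]
                    + 'E_P[(fun w => eps k.+1 w ^+ 2)%R])%E.
Proof.
move=> adm kN xL2 uL2.
set Y := fun w => _.
have YL2 : Y \in Lfun P 2%:E by apply: Lfun_lin => //; rewrite ler1n.
have eL2 := eps_L2 kN.
have kY : known_at x0 eps k Y.
  have kx := known_state adm (ltnW kN).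
  have ku := known_feedback adm kN kx.
  by apply: measurable_funD; exact: measurable_funM.
have Ye := Lfun2_mul_Lfun1 YL2 eL2.
have cov0 : (covariance P Y (eps k.+1) = 0)%E.
  rewrite (covarianceE (Lfun12 YL2) (Lfun12 eL2) Ye) eps_mean0 // mule0 sube0.
  rewrite unlock.
  apply: (known_ortho_eps x0_eps_indep) kY _ _ => //.
  - by move=> j jN; apply/Lfun1_integrable/eps_L1.
  - exact: Lfun_measurable YL2.
  - exact/Lfun1_integrable.
rewrite (_ : x u k.+1 = Y \+ eps k.+1) // varianceD // cov0 mule0 adde0.
by rewrite [X in (_ + X = _)%E]varianceE // eps_mean0 // expe2 mule0 sube0.
Qed.

(** The candidate for the optimal cost-to-go from time [k], as a function of
    the mean and variance of the state. *)
Definition value u k : R :=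
  alpha k * fine 'V_P[x u k] + alphabar k * m u k ^+ (2 * p) + gammabar k.

(** The loss in optimality at time [k]: a multiple of the variance of the
    deviation of [u k] from the optimal feedback, plus the excess of the mean
    part. *)
Definition gap u k : R :=
  (r k + alpha k.+1 * b k ^+ 2) * fine 'V_P[(fun w => u k w + K k * x u k w)%R]
  + mean_gap p a b rbar alphabar k (m u k) (mu_ u k).

Lemma dev_denom_gt0 k : (k < N)%N -> 0 < r k + alpha k.+1 * b k ^+ 2.
Proof.
move=> kN; rewrite ltr_pwDl ?r_gt0 // mulr_ge0 ?sqr_ge0 //.
exact/ltW/alpha_gt0.
Qed.

(** The Bellman identity, with the suboptimality made explicit.  On the variance
    side this is completing the square in the covariance form; the recursions
    for [alpha] and [alphabar] are what remains after the squares are split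
    off. *)
Lemma value_step u k : admissible u -> (k < N)%N ->
  x u k \in Lfun P 2%:E -> (u k : T -> R) \in Lfun P 2%:E ->
  q k * fine 'V_P[x u k] + qbar k * m u k ^+ (2 * p)
  + r k * fine 'V_P[u k] + rbar k * mu_ u k ^+ (2 * p) + value u k.+1
  = value u k + gap u k.
Proof.
move=> adm kN xL2 uL2; rewrite /value /gap /mean_gap.
have uL1 j : (j < N)%N -> (u j : T -> R) \in Lfun P 1%E by move=> /adm[].
rewrite mean_state // variance_state // variance_lin //.
have := gammabar_rec kN.
have /expectation_fin_num : (fun w => eps k.+1 w ^+ 2) \in Lfun P 1%E.
  by apply/Lfun1_integrable/Lfun2_integrable_sqr/eps_L2.
case: ('E_P[_])%E => [s| |] // _ /= [->].
have -> : (fun w => u k w + K k * x u k w) =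
    (fun w => K k * x u k w + 1 * u k w).
  by apply/funext => w; rewrite mul1r addrC.
rewrite variance_lin //=.
set vx := fine 'V_P[x u k]; set vu := fine 'V_P[u k].
set c := fine (covariance _ _ _).
have D0 := dev_denom_gt0 kN.
have KD : (r k + alpha k.+1 * b k ^+ 2) * K k = alpha k.+1 * b k * a k.
  by rewrite /K mulrC divfK // gt_eqF.
have -> : alpha k =
    q k + alpha k.+1 * a k ^+ 2 - alpha k.+1 * b k * a k * K k.
  by rewrite alpha_rec // /K; field; rewrite gt_eqF.
rewrite (alphabar_rec kN).
have -> : (r k + alpha k.+1 * b k ^+ 2)
    * (K k ^+ 2 * vx + 1 ^+ 2 * vu + 2 * (K k * 1 * c))
  = (r k + alpha k.+1 * b k ^+ 2) * K k * (K k * vx + 2 * c)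
    + (r k + alpha k.+1 * b k ^+ 2) * vu by ring.
rewrite KD; ring.
Qed.

Lemma gap_ge0 u k : (k < N)%N -> 0 <= gap u k.
Proof.
move=> kN; apply: addr_ge0.
  by rewrite mulr_ge0 ?(ltW (dev_denom_gt0 kN)) // fine_ge0 // variance_ge0.
by apply: mean_gap_ge0; rewrite ?rbar_gt0 ?alphabar_gt0.
Qed.

(** Telescoping the Bellman identity: the cost is a constant determined by [x0]
    and the noise, plus nonnegative gaps. *)
Lemma loss_value u : admissible u -> (x0 : T -> R) \in Lfun P 2%:E ->
  (forall k, (k < N)%N -> (u k : T -> R) \in Lfun P 2%:E) ->
  loss u = (value u 0 + \sum_(0 <= k < N) gap u k)%:E.
Proof.
move=> adm x0L2 uL2.
have xL2 k : (k <= N)%N -> x u k \in Lfun P 2%:E.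
  by move=> kN; apply: state_L2 => // j jk; apply: uL2; exact: leq_trans kN.
pose stage k : R := q k * fine 'V_P[x u k] + qbar k * m u k ^+ (2 * p)
  + r k * fine 'V_P[u k] + rbar k * mu_ u k ^+ (2 * p).
rewrite /loss (eq_big_nat _ _ (F2 := fun k => (stage k)%:E)); last first.
  move=> k /andP[_ kN].
  rewrite /stage !EFinD !(EFinM _ (fine _)) !fineK // variance_fin_num //.
  - exact: uL2.
  - exact: xL2 (ltnW kN).
rewrite sumEFin -(fineK (variance_fin_num (xL2 _ (leqnn N)))) -!(EFinM, EFinD).
congr EFin.
have -> : \sum_(0 <= k < N) stage k =
    \sum_(0 <= k < N) ((value u k - value u k.+1) + gap u k).
  apply: eq_big_nat => k /andP[_ kN].
  rewrite addrAC -value_step ?uL2 ?xL2 // ?(ltnW kN) // /stage; ring.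
have tele : \sum_(0 <= k < N) (value u k - value u k.+1) = value u 0 - value u N.
  rewrite -[RHS]opprB -(telescope_sumr (value u) (leq0n N)) -sumrN.
  by apply: eq_bigr => k _; rewrite opprB.
rewrite big_split /= tele /value alphaN alphabarN gammabarN; ring.
Qed.

(** All terms of the cost are nonnegative and the weights of the variances are
    positive, so a finite cost makes every variance finite. *)
Lemma loss_lty_L2 u : admissible u -> (loss u < +oo)%E ->
  (x0 : T -> R) \in Lfun P 2%:E /\
  (forall k, (k < N)%N -> (u k : T -> R) \in Lfun P 2%:E).
Proof.
move=> adm Lu.
have uL1 j : (j < N)%N -> (u j : T -> R) \in Lfun P 1%E by move=> /adm[].
have scale_lty (c : R) (X : T -> R) : 0 < c -> (c%:E * 'V_P[X] < +oo)%E ->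
    ('V_P[X] < +oo)%E.
  move=> c0; case: ('V_P[X])%E => [v| |] //; rewrite ?ltry //.
  by rewrite gt0_muley ?lte_fin.
have even_ge0 (z : R) : 0 <= z ^+ (2 * p) by rewrite exprM exprn_ge0 ?sqr_ge0.
pose stage k := ((q k)%:E * 'V_P[x u k] + (qbar k * m u k ^+ (2 * p))%:E
    + (r k)%:E * 'V_P[u k] + (rbar k * mu_ u k ^+ (2 * p))%:E)%E.
have V0 (c : R) (X : T -> R) : 0 < c -> (0 <= c%:E * 'V_P[X])%E.
  by move=> c0; rewrite mule_ge0 ?variance_ge0 // lee_fin ltW.
have M0 (c z : R) : 0 < c -> (0 <= (c * z ^+ (2 * p))%:E)%E.
  by move=> c0; rewrite lee_fin; apply: mulr_ge0; [exact: ltW|exact: even_ge0].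
have stage_ge0 k : (k < N)%N -> (0 <= stage k)%E.
  by move=> kN; rewrite !adde_ge0 // ?V0 ?M0 ?q_gt0 ?qbar_gt0 ?r_gt0 ?rbar_gt0 //
    ltnW.
have sum_ge0 : (0 <= \sum_(0 <= k < N) stage k)%E.
  by rewrite big_nat sume_ge0 // => k /andP[_ kN]; exact: stage_ge0.
have termN_ge0 :
    (0 <= (q N)%:E * 'V_P[x u N] + (qbar N * m u N ^+ (2 * p))%:E)%E.
  by rewrite adde_ge0 ?V0 ?M0 ?q_gt0 ?qbar_gt0.
have stage_lty k : (k < N)%N -> (stage k < +oo)%E.
  move=> kN; apply: le_lt_trans Lu; rewrite /loss -/(stage _).
  rewrite (bigD1_seq k) /= ?mem_index_iota ?iota_uniq ?kN // addeC.
  rewrite -addeA leeDl // adde_ge0 // big_seq_cond sume_ge0 // => j.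
  by rewrite mem_index_iota => /andP[/andP[_ jN] _]; exact: stage_ge0.
have stage_var k : (k < N)%N -> ('V_P[x u k] < +oo)%E /\ ('V_P[u k] < +oo)%E.
  move=> kN; have := stage_lty k kN.
  have [? ? ? ?] : [/\ 0 < q k, 0 < qbar k, 0 < r k & 0 < rbar k].
    by rewrite q_gt0 ?qbar_gt0 ?r_gt0 ?rbar_gt0 // ltnW.
  move=> st; split.
  - apply: (scale_lty (q k)) => //; apply: le_lt_trans st.
    by rewrite /stage -!addeA leeDl // !adde_ge0 // ?V0 ?M0.
  - apply: (scale_lty (r k)) => //; apply: le_lt_trans st.
    by rewrite /stage -addeA addeC -addeA leeDl // !adde_ge0 // ?V0 ?M0.
split; last first.
  move=> k kN; apply: variance_lty_Lfun2; first exact: uL1.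
  by case: (stage_var k kN).
apply: variance_lty_Lfun2 => //.
(* For N = 0 the variance of x0 is weighted by the terminal cost. *)
have [N0|] := posnP N; last by move=> /stage_var[].
apply: (scale_lty (q 0)); first exact: q_gt0.
apply: le_lt_trans Lu; rewrite /loss -addeA N0 leeDl //.
by rewrite big_geq // adde0 M0 // qbar_gt0.
Qed.

(** A vanishing gap forces the deviation [u k + K (x k)] to be constant and the
    mean of [u k] to be the minimiser, which is the feedback law. *)
Lemma gap_eq0_ae u k : (k < N)%N ->
  x u k \in Lfun P 2%:E -> (u k : T -> R) \in Lfun P 2%:E ->
  gap u k = 0 ->
  {ae P, forall w, u k w = - K k * (x u k w - m u k) - Kbar k * m u k}.
Proof.
move=> kN xL2 uL2 /eqP; have D0 := dev_denom_gt0 kN.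
have rk := rbar_gt0 kN; have ak := alphabar_gt0 kN.
set dev := fun w => u k w + K k * x u k w; rewrite /gap -/dev.
have devE : dev = (fun w => 1 * u k w + K k * x u k w).
  by apply/funext => w; rewrite mul1r.
have dL2 : dev \in Lfun P 2%:E.
  by rewrite devE; apply: Lfun_lin => //; rewrite ler1n.
have gm_ge0 : 0 <= mean_gap p a b rbar alphabar k (m u k) (mu_ u k).
  exact: mean_gap_ge0.
rewrite paddr_eq0 // ?mulr_ge0 ?(ltW D0) ?fine_ge0 ?variance_ge0 //.
rewrite mulf_eq0 gt_eqF //= => /andP[Vd0 gm0].
have muE : mu_ u k = - Kbar k * m u k.
  apply/eqP; apply: contraTT gm0 => ne.
  by rewrite gt_eqF // mean_gap_gt0.
have : ('V_P[dev] = 0)%E by rewrite -(fineK (variance_fin_num dL2)) (eqP Vd0).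
move=> /(variance_eq0_ae dL2); apply: filterS => w.
rewrite {2}devE mean_lin ?Lfun12 // muE /dev => E.
have -> : u k w = u k w + K k * x u k w - K k * x u k w by rewrite addrK.
rewrite E; ring.
Qed.

(** * The closed loop *)

Definition feedback k (X : T -> R) (w : T) : R :=
  - K k * (X w - mean P X) - Kbar k * mean P X.

Lemma measurable_feedback k (X : {RV P >-> R}) :
  measurable_fun setT (feedback k X).
Proof.
apply: measurable_funB => //; apply: measurable_funM => //.
exact: measurable_funB.
Qed.

HB.instance Definition _ k (X : {RV P >-> R}) :=
  @isMeasurableFun.Build _ _ T R (feedback k X) (@measurable_feedback k X).

Definition closed_step k (X : {RV P >-> R}) (w : T) : R :=
  a k * X w + b k * feedback k X w + eps k.+1 w.

Lemma measurable_closed_step k (X : {RV P >-> R}) :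
  measurable_fun setT (closed_step k X).
Proof.
by apply: measurable_funD => //; apply: measurable_funD; apply: measurable_funM.
Qed.

HB.instance Definition _ k (X : {RV P >-> R}) :=
  @isMeasurableFun.Build _ _ T R (closed_step k X) (@measurable_closed_step k X).

(** The trajectory under the feedback law has to be built before the control,
    because a control is a process given in advance and not a feedback. *)
Fixpoint closed_state k : {RV P >-> R} :=
  if k is j.+1 then closed_step j (closed_state j) else x0.

Definition closed_control k : {RV P >-> R} := feedback k (closed_state k).

Lemma state_closed_control k : x closed_control k = closed_state k.
Proof.
by elim: k => [//|k IH] /=; apply/funext => w; rewrite IH.
Qed.

Lemma closed_controlE k w :
  closed_control k w = feedback k (x closed_control k) w.
Proof. by rewrite state_closed_control. Qed.

Lemma feedback_lin k X :
  feedback k X = (fun w => - K k * X w + 1 * cst ((K k - Kbar k) * mean P X) w).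
Proof. by apply/funext => w; rewrite /feedback /=; ring. Qed.

Lemma feedback_Lfun r0 k X : 1 <= r0 -> X \in Lfun P r0%:E ->
  feedback k X \in Lfun P r0%:E.
Proof.
by move=> r1 LX; rewrite feedback_lin; apply: Lfun_lin => //; exact: Lfun_cst.
Qed.

Lemma closed_state_L1 k : (k <= N)%N -> (closed_state k : T -> R) \in Lfun P 1%E.
Proof.
elim: k => [//|k IH] kN /=; have {}IH := IH (ltnW kN).
apply: rpredD => //; last exact: eps_L1.
by apply: Lfun_lin => //; exact: feedback_Lfun.
Qed.

Lemma closed_control_L2 k : (x0 : T -> R) \in Lfun P 2%:E -> (k < N)%N ->
  (closed_control k : T -> R) \in Lfun P 2%:E.
Proof.
move=> x0L2 kN; apply: feedback_Lfun; first by rewrite ler1n.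
rewrite -state_closed_control; elim: k {-2}k (leqnn k) kN => [|n IH] k.
  by rewrite leqn0 => /eqP ->.
move=> kn kN; apply: state_L2 (ltnW kN) => // j jk.
apply: feedback_Lfun; first by rewrite ler1n.
rewrite -state_closed_control; apply: IH; last exact: ltn_trans kN.
by rewrite -ltnS; exact: leq_trans kn.
Qed.

(** The mean in the feedback law is read off the distribution of the state,
    which the feedback function is allowed to use. *)
Lemma admissible_closed_control : admissible closed_control.
Proof.
move=> k kN; have xL1 := closed_state_L1 (ltnW kN).
split; first exact: feedback_Lfun.
exists (fun mu y => - K k * (y - fine (\int[mu]_z z%:E)%E)
                    - Kbar k * fine (\int[mu]_z z%:E)%E).
split=> [mu|w].
  apply: measurable_funB => //; apply: measurable_funM => //.
  exact: measurable_funB.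
have {}xL1 : x closed_control k \in Lfun P 1%E by rewrite state_closed_control.
rewrite closed_controlE /feedback.
suff -> : mean P (x closed_control k) =
  fine (\int[distribution P (x closed_control k)]_z z%:E)%E by [].
rewrite integral_distribution //; last first.
  exact/Lfun1_integrable.
by rewrite /mean unlock.
Qed.

Lemma gap_closed_control k : (k < N)%N -> gap closed_control k = 0.
Proof.
move=> kN; rewrite /gap.
have xL1 := closed_state_L1 (ltnW kN).
rewrite (_ : (fun w => _) = cst ((K k - Kbar k) * m closed_control k)); last first.
  by apply/funext => w; rewrite closed_controlE /feedback /=; ring.
rewrite variance_cst mulr0 add0r.
have -> : mu_ closed_control k = - Kbar k * m closed_control k.
  rewrite (_ : (closed_control k : T -> R) = feedback k (x closed_control k));
    last first.
    by apply/funext => w; exact: closed_controlE.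
  rewrite feedback_lin mean_lin ?state_closed_control ?Lfun_cst //.
  by rewrite {2}/mean expectation_cst /=; ring.
by apply: mean_gap_opt.
Qed.

Local Notation expected_cost := (expected_cost p N a b q r qbar rbar x0 eps).
Local Notation optimal := (optimal p N a b q r qbar rbar x0 eps).

Lemma expected_costE u : expected_cost u = loss u.
Proof. by rewrite /Defs.expected_cost integral_cst //= probability_setT mule1. Qed.

Lemma loss_closed_control : (x0 : T -> R) \in Lfun P 2%:E ->
  loss closed_control = (value closed_control 0)%:E.
Proof.
move=> x0L2; rewrite loss_value //; last 2 first.
- exact: admissible_closed_control.
- by move=> k; exact: closed_control_L2.
by rewrite big_nat big1 ?addr0 // => k /andP[_ kN]; exact: gap_closed_control.
Qed.

(** If [x0] has infinite variance every cost is infinite and there is nothing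
    to compare; otherwise the costs differ by the sum of the gaps. *)
Lemma optimal_closed_control : optimal closed_control.
Proof.
split=> [|v adm]; first exact: admissible_closed_control.
rewrite !expected_costE.
have [->|Lv] := eqVneq (loss v) +oo%E; first by rewrite leey.
have [x0L2 vL2] : (x0 : T -> R) \in Lfun P 2%:E /\
    (forall k, (k < N)%N -> (v k : T -> R) \in Lfun P 2%:E).
  by apply: loss_lty_L2 => //; rewrite ltey.
rewrite loss_closed_control // (loss_value adm) // lee_fin /value /= lerDl.
by rewrite big_nat sumr_ge0 // => k /andP[_ kN]; exact: gap_ge0.
Qed.

Lemma optimal_control_ae u : optimal u -> (expected_cost u < +oo)%E ->
  forall k, (k < N)%N ->
  {ae P, forall w, u k w = - K k * (x u k w - m u k) - Kbar k * m u k}.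
Proof.
move=> [adm opt]; rewrite expected_costE => Lu k kN.
have [x0L2 uL2] := loss_lty_L2 adm Lu.
have := opt _ admissible_closed_control; rewrite !expected_costE.
rewrite loss_closed_control // (loss_value adm) // lee_fin /value /= gerDl.
move=> gaps_le0.
have gaps0 : \sum_(0 <= j < N) gap u j = 0.
  apply: le_anti; rewrite gaps_le0 big_nat sumr_ge0 // => j /andP[_ jN].
  exact: gap_ge0.
apply: gap_eq0_ae; rewrite ?uL2 //.
  by apply: state_L2 (ltnW kN) => // j jk; apply: uL2; exact: ltn_trans kN.
apply: le_anti; rewrite gap_ge0 // andbT -gaps0.
rewrite (bigD1_seq k) /= ?mem_index_iota ?iota_uniq // lerDl.
rewrite big_seq_cond sumr_ge0 // => j.
by rewrite mem_index_iota => /andP[/andP[_ jN] _]; exact: gap_ge0.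
Qed.

End value_function.

Theorem proposition4 (d : measure_display) (T : measurableType d)
    (R : realType) (P : probability T R) (p N : nat)
    (a b q r qbar rbar : nat -> R)
    (x0 : {RV P >-> R}) (eps : nat -> {RV P >-> R})
    (alphabar gammabar alpha : nat -> R)
    (p_ge1 : (1 <= p)%N)
    (q_gt0 : forall k, (k <= N)%N -> 0 < q k)
    (qbar_gt0 : forall k, (k <= N)%N -> 0 < qbar k)
    (r_gt0 : forall k, (k < N)%N -> 0 < r k)
    (rbar_gt0 : forall k, (k < N)%N -> 0 < rbar k)
    (eps0 : forall w, eps 0%N w = 0)
    (eps_L2 : forall k, (k <= N)%N -> (eps k : T -> R) \in Lfun P 2%:E)
    (eps_mean0 : forall k, (k <= N)%N -> ('E_P[eps k] = 0)%E)
    (eps_past : zero_mean_given_past eps N)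
    (x0_L1 : (x0 : T -> R) \in Lfun P 1%E)
    (x0_eps_indep : indep_rv_process x0 eps N)
    (alphabarN : alphabar N = qbar N)
    (gammabarN : gammabar N = 0)
    (alphaN : alpha N = q N)
    (alphabar_rec : forall k, (k < N)%N ->
      alphabar k = qbar k
        + rbar k * mean_gain p a b rbar alphabar k ^+ (2 * p)
        + alphabar k.+1
          * (a k - b k * mean_gain p a b rbar alphabar k) ^+ (2 * p))
    (gammabar_rec : forall k, (k < N)%N ->
      ((gammabar k)%:E = (gammabar k.+1)%:E
        + (alpha k.+1)%:E * 'E_P[(fun w => eps k.+1 w ^+ 2)%R])%E)
    (alpha_rec : forall k, (k < N)%N ->
      alpha k = q k
        + r k * (alpha k.+1 * b k * a k / (r k + alpha k.+1 * b k ^+ 2)) ^+ 2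
        + alpha k.+1
          * (a k - alpha k.+1 * b k ^+ 2 * a k
                   / (r k + alpha k.+1 * b k ^+ 2)) ^+ 2) :
  let x := state a b x0 eps in
  let ustar (u : nat -> {RV P >-> R}) (k : nat) (w : T) : R :=
    - dev_gain a b r alpha k * (x u k w - mean P (x u k))
    - mean_gain p a b rbar alphabar k * mean P (x u k) in
  (exists u : nat -> {RV P >-> R},
     (forall k, (k < N)%N -> forall w, u k w = ustar u k w) /\
     optimal p N a b q r qbar rbar x0 eps u) /\
  (forall u : nat -> {RV P >-> R},
     optimal p N a b q r qbar rbar x0 eps u ->
     (expected_cost p N a b q r qbar rbar x0 eps u < +oo)%E ->
     forall k, (k < N)%N -> {ae P, forall w, u k w = ustar u k w}).
Proof.
move=> x ustar; split.
  exists (closed_control p a b r rbar x0 eps alphabar alpha); split.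
    by move=> k kN w; exact: closed_controlE.
  exact: (optimal_closed_control p_ge1 q_gt0 qbar_gt0 r_gt0 rbar_gt0 eps_L2
    eps_mean0 eps_past x0_L1 x0_eps_indep alphabarN gammabarN alphaN
    alphabar_rec gammabar_rec alpha_rec).
exact: (optimal_control_ae p_ge1 q_gt0 qbar_gt0 r_gt0 rbar_gt0 eps_L2
  eps_mean0 eps_past x0_L1 x0_eps_indep alphabarN gammabarN alphaN
  alphabar_rec gammabar_rec alpha_rec).
Qed.
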